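(* Let $k\ge 1$ be an integer, let $a^{(1)},\dots,a^{(k)}\in\mathbb R$ with $a^{(k)}\neq 0$, let $\mu\in\mathbb R\setminus\{0\}$, $s\in\mathbb N$ and $f\in L_\mu^s$. Consider the difference equation $$y_{n+k}+a^{(1)}y_{n+k-1}+\dots+a^{(k)}y_n=f_n ,$$ i.e. $Ry=f$ with $R=T^k+a^{(1)}T^{k-1}+\dots+a^{(k)}I$, for an unknown $y\in S_{\mathbb R}$. 1. Suppose $\mu$ is not a characteristic number of the equation. Then the equation has a particular solution $y^{(0)}\in L_\mu^s$, and its coefficient column $\mathbf y$ in the basis $\{\mu^n,n\mu^n,\dots,n^s\mu^n\}$ can be found from the linear system $R_\mu^s\,\mathbf y=\mathbf f$, where $R_\mu^s=(\mathcal T_\mu^s)^k+a^{(1)}(\mathcal T_\mu^s)^{k-1}+\dots+a^{(k)}I$ and $\mathbf f$ is the coefficient column of $f$ in the same basis. This system has a unique solution. 2. Suppose $\mu$ is a characteristic number of the equation of multiplicity $m\ge 1$. Then the equation has a particular solution $y^{(0)}\in L_\mu^{m+s}=K_\mu^m\oplus L_\mu^{m,s}$, where $$K_\mu^m=\operatorname{span}\{\mu^n,n\mu^n,\dots,n^{m-1}\mu^n\}=\ker R|_{L_\mu^{m+s}},\qquad L_\mu^{m,s}=\operatorname{span}\{n^m\mu^n,n^{m+1}\mu^n,\dots,n^{m+s}\mu^n\}.$$ The coefficient column $\mathbf y_p$, in the basis $\{n^m\mu^n,\dots,n^{m+s}\mu^n\}$, of the projection of $y^{(0)}$ onto $L_\mu^{m,s}$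 (along $K_\mu^m$) can be found from the linear system $R_\mu^{m,s}\,\mathbf y_p=\mathbf f$, where $R_\mu^{m,s}$ is the $(s+1)\times(s+1)$ matrix obtained by deleting the first $m$ columns and the last $m$ rows of the matrix $(\mathcal T_\mu^{m+s})^k+a^{(1)}(\mathcal T_\mu^{m+s})^{k-1}+\dots+a^{(k)}I$, and $\mathbf f$ is the coefficient column of $f$ in the basis $\{\mu^n,n\mu^n,\dots,n^s\mu^n\}$ of $L_\mu^s$. This system has a unique solution.
   Context: $\mathbb N_0=\{0,1,2,\dots\}$, $e_0=(1,0,0,\dots)$. $S_{\mathbb R}$ is the real vector space of real-valued sequences indexed by $\mathbb N_0$ modulo $\operatorname{span}\{e_0\}$ (so sequences are identified when they agree except possibly at index $0$). $T$ is the shift operator $(Ty)_n=y_{n+1}$, which is well defined on $S_{\mathbb R}$ since $Te_0=0$; $I$ denotes the identity operator (or identity matrix). Expressions such as $n^j\mu^n$ denote the sequence $(n^j\mu^n)_{n\ge 0}$ (with $n^0=1$) and its class in $S_{\mathbb R}$. For real $\mu\ne0$ and $s\in\mathbb N$, $L_\mu^s=\operatorname{span}_{\mathbb R}\{\mu^n,n\mu^n,\dots,n^s\mu^n\}\subset S_{\mathbb R}$; this is a $T$-invariant subspace of dimension $s+1$. $\mathcal T_\mu^s$ is the matrix of the restriction $T|_{L_\mu^s}$ in the basis $\{\mu^n,n\mu^n,\dots,n^s\mu^n\}$ (the $j$-th column holds the coordinates of the image of the $j$-th basis vector). A characteristic number of the equation is a root of $\lambda^k+a^{(1)}\lambda^{k-1}+\dots+a^{(k)}$,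 and its multiplicity is its multiplicity as a root. ''Can be found from the system'' means: a column is the coefficient column of a particular solution in the stated space (respectively, of the projection of such a solution) if and only if it solves the system. *)

(* Defs.v *)
From HB Require Import structures.
From mathcomp Require Import all_boot all_order all_algebra.
From mathcomp Require Import generic_quotient ring_quotient.
From mathcomp Require Import boolp classical_sets functions reals.

Set Implicit Arguments.
Unset Strict Implicit.
Unset Printing Implicit Defensive.

Import Order.TTheory GRing.Theory Num.Theory.
Import Quotient.

Local Open Scope classical_set_scope.
Local Open Scope ring_scope.
Local Open Scope quotient_scope.

Section SequenceSpace.
Variable R : realType.

Definition rseq : Type := nat -> R^o.
HB.instance Definition _ := GRing.Lmodule.on rseq.

Definition e0 : rseq := fun n => (n == 0%N)%:R.

Definition span_e0 : pred rseq := fun y => `[< exists c : R, y = c *: e0 >].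

Lemma span_e0P y : reflect (exists c : R, y = c *: e0) (y \in span_e0).
Proof. exact: asboolP. Qed.

Fact span_e0_zmod_closed : zmod_closed span_e0.
Proof.
split=> [|y z /span_e0P[c ->] /span_e0P[d ->]]; apply/span_e0P.
  by exists 0; rewrite scale0r.
by exists (c - d); rewrite scalerBl.
Qed.
HB.instance Definition _ := GRing.isZmodClosed.Build rseq span_e0
  span_e0_zmod_closed.

(* The space of sequences modulo their value at index 0. *)
Definition SR : Type := {quot GRing.ZmodClosed.clone rseq span_e0 _}.
HB.instance Definition _ := Choice.on SR.
HB.instance Definition _ := EqQuotient.on SR.
HB.instance Definition _ := ZmodQuotient.on SR.

Definition cls (y : rseq) : SR := \pi_SR y.

Lemma cls_eq (y z : rseq) : (cls y = cls z) <-> exists c : R, y - z = c *: e0.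
Proof.
split=> [/eqP|[c yz]].
  by rewrite /cls eqmodE => /span_e0P.
by apply/eqP; rewrite /cls eqmodE; apply/span_e0P; exists c.
Qed.

Lemma clsK (x : SR) : cls (repr x) = x. Proof. exact: reprK. Qed.

Lemma clsB (y z : rseq) : cls (y - z) = cls y - cls z.
Proof. by rewrite /cls !piE. Qed.

Lemma clsD (y z : rseq) : cls (y + z) = cls y + cls z.
Proof. by rewrite /cls !piE. Qed.

Lemma cls0 : cls 0 = 0. Proof. by rewrite /cls !piE. Qed.

Definition SR_scale (c : R) (x : SR) : SR := cls (c *: repr x).

Lemma SR_scaleE (c : R) (y : rseq) : SR_scale c (cls y) = cls (c *: y).
Proof.
have /cls_eq[d hd] := clsK (cls y).
by apply/cls_eq; exists (c * d); rewrite -scalerBr hd scalerA.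
Qed.

Fact SR_scaleA a b v : SR_scale a (SR_scale b v) = SR_scale (a * b) v.
Proof. by rewrite -[v]clsK !SR_scaleE scalerA. Qed.
Fact SR_scale1 : left_id 1 SR_scale.
Proof. by move=> v; rewrite -[v]clsK SR_scaleE scale1r. Qed.
Fact SR_scaleDr : right_distributive SR_scale +%R.
Proof.
by move=> a u v; rewrite -[u]clsK -[v]clsK -clsD !SR_scaleE -clsD scalerDr.
Qed.
Fact SR_scaleDl v : {morph SR_scale^~ v : a b / a + b}.
Proof. by move=> a b /=; rewrite -[v]clsK !SR_scaleE -clsD scalerDl. Qed.
HB.instance Definition _ := GRing.Zmodule_isLmodule.Build R SR
  SR_scaleA SR_scale1 SR_scaleDr SR_scaleDl.

Lemma clsZ (c : R) (y : rseq) : cls (c *: y) = c *: cls y.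
Proof. by rewrite -SR_scaleE. Qed.

Lemma cls_sum (I : Type) (r : seq I) (F : I -> rseq) :
  cls (\sum_(i <- r) F i) = \sum_(i <- r) cls (F i).
Proof. exact: (big_morph cls clsD cls0). Qed.

Definition seq_shift (y : rseq) : rseq := fun n => y n.+1.

Definition shift_op (x : SR) : SR := cls (seq_shift (repr x)).

Lemma shift_opE (y : rseq) : shift_op (cls y) = cls (seq_shift y).
Proof.
have /cls_eq[d hd] := clsK (cls y).
apply/cls_eq; exists 0; rewrite scale0r; apply/funext => n.
have /(congr1 (fun g : rseq => g n.+1)) := hd.
by rewrite /= !fctE => hn; rewrite [LHS]hn [d *: _]mulr0.
Qed.

Fact shift_op_is_linear : linear shift_op.
Proof.
move=> c u v; rewrite -[u]clsK -[v]clsK -clsZ -clsD !shift_opE -clsZ -clsD.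
by congr cls.
Qed.
HB.instance Definition _ := GRing.isLinear.Build R SR SR *:%R shift_op
  shift_op_is_linear.

(* The class of n^j mu^n; since x ^+ 0 = 1 also at x = 0, n^0 = 1 for all n. *)
Definition npow (mu : R) (j : nat) : SR :=
  cls (fun n : nat => n%:R ^+ j * mu ^+ n).

End SequenceSpace.

Section Coordinates.
Variables (R : realType) (V : lmodType R) (d : nat) (b : 'I_d -> V).

Definition lincomb (c : 'cV[R]_d) : V := \sum_i c i 0 *: b i.

Definition lin_span : set V := range lincomb.

Definition free_family : Prop := forall c, lincomb c = 0 -> c = 0.

(* The coordinate column of y in the family b; a junk value outside lin_span. *)
Definition coordcol (y : V) : 'cV[R]_d := xget 0 [set c | y = lincomb c].

(* The matrix, in the basis b, of the restriction to lin_span of an operator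
   that leaves lin_span invariant. *)
Definition matrix_of (A : V -> V) : 'M[R]_d :=
  \matrix_(i, j) coordcol (A (b j)) i 0.

Lemma coordcolP y : lin_span y -> lincomb (coordcol y) = y.
Proof. by case=> c _ <-; rewrite /coordcol; case: xgetP => // /(_ c) /(_ erefl). Qed.

Lemma coordcolK : free_family -> cancel lincomb coordcol.
Proof.
move=> bfree c; apply/eqP; rewrite -subr_eq0; apply/eqP/bfree.
have /eqP := @coordcolP (lincomb c) (ex_intro2 _ _ c I erefl).
rewrite -subr_eq0 /lincomb -sumrB => /eqP h; rewrite -[RHS]h.
by apply: eq_bigr => i _; rewrite !mxE scalerBl.
Qed.

End Coordinates.

Definition direct_sum (V : zmodType) (W U1 U2 : set V) : Prop :=
  W = [set u + v | u in U1 & v in U2] /\ U1 `&` U2 = [set 0].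

(* v is the projection of y onto U2 along U1. *)
Definition is_projection (V : zmodType) (U1 U2 : set V) (y v : V) : Prop :=
  U2 v /\ U1 (y - v).

Section Equation.
Variable R : realType.
Implicit Types (mu : R) (k m s p d : nat) (a : nat -> R).

(* n^p mu^n, n^(p+1) mu^n, ..., n^(p+d-1) mu^n *)
Definition pbasis mu p d : 'I_d -> SR R := fun i => npow mu (p + i).

Definition Lspace mu s : set (SR R) := lin_span (pbasis mu 0 (d:=s.+1)).
Definition Kspace mu m : set (SR R) := lin_span (pbasis mu 0 (d:=m)).
Definition Lmspace mu m s : set (SR R) := lin_span (pbasis mu m (d:=s.+1)).

Definition Tmx mu s : 'M[R]_s.+1 :=
  matrix_of (pbasis mu 0 (d:=s.+1)) (@shift_op R).

(* Only a 1, ..., a k are used. *)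
Definition charpol k a : {poly R} :=
  'X^k + \sum_(1 <= i < k.+1) a i *: 'X^(k - i).

Definition Rop k a (y : SR R) : SR R :=
  iter k (@shift_op R) y
  + \sum_(1 <= i < k.+1) a i *: iter (k - i) (@shift_op R) y.

Definition Rmx k a mu s : 'M[R]_s.+1 :=
  Tmx mu s ^+ k + \sum_(1 <= i < k.+1) a i *: Tmx mu s ^+ (k - i).

(* Deletes the last m rows and the first m columns: entry (i, j) is the entry
   (i, m + j) of A (both inord indices are in range). *)
Definition del_corner m s (A : 'M[R]_((m + s).+1)) : 'M[R]_s.+1 :=
  mxsub (fun i : 'I_s.+1 => inord i) (fun j : 'I_s.+1 => inord (m + j)) A.

Definition Rmmx k a mu m s : 'M[R]_s.+1 := del_corner (Rmx k a mu (m + s)).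

Lemma pbasis_free mu p d : mu != 0 -> free_family (pbasis mu p (d:=d)).
Proof.
move=> mu0 c; rewrite /lincomb /pbasis /npow.
under eq_bigr => i _ do rewrite -clsZ.
rewrite -cls_sum -(cls0 R) => /cls_eq[x]; rewrite subr0 => hx.
pose q : {poly R} := \sum_(i < d) c i 0 *: 'X^(p + i).
have q_root n : (0 < n)%N -> root q n%:R.
  move=> n0; have := congr1 (fun g : rseq R => g n) hx.
  rewrite [X in _ = X -> _]/= [X in _ = X -> _](_ : _ = 0); last first.
    by case: n n0 => // n _; exact: mulr0.
  rewrite fct_sumE => hn; apply/rootP; rewrite /q horner_sum.
  have munz : mu ^+ n != 0 by rewrite expf_neq0.
  apply: (mulIf munz); rewrite mul0r -[RHS]hn mulr_suml.
  by apply: eq_bigr => i _; rewrite hornerZ hornerXn -mulrA.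
have q0 : q = 0.
  apply/eqP/negPn/negP => qn0.
  have := @max_poly_roots R q [seq n%:R | n <- iota 1 (size q)] qn0.
  rewrite size_map size_iota ltnn map_inj_uniq ?iota_uniq; last first.
    by move=> u v /eqP; rewrite eqr_nat => /eqP.
  move=> h; suff: false by []; apply: h => //.
  by apply/allP => _ /mapP[n nI ->]; apply: q_root; move: nI; rewrite mem_iota => /andP[].
apply/matrixP => i j; rewrite [j]ord1 mxE.
have := congr1 (fun r : {poly R} => r`_(p + i)) q0.
rewrite coef0 coef_sum (bigD1 i) //= coefZ coefXn eqxx mulr1 big1 ?addr0 // => l li.
by rewrite coefZ coefXn eqn_add2l eq_sym (inj_eq val_inj) (negPf li) mulr0.
Qed.

Lemma shift_op_npow mu j :
  shift_op (npow mu j) = \sum_(i < j.+1) (mu * 'C(j, i)%:R) *: npow mu i.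
Proof.
rewrite /npow shift_opE; under eq_bigr => i _ do rewrite -clsZ.
rewrite -cls_sum; congr cls; apply/funext => n; rewrite fct_sumE /seq_shift.
rewrite -natr1 addrC exprDn mulr_suml; apply: eq_bigr => i _.
rewrite expr1n mul1r exprS -mulr_natl.
rewrite -[RHS]/((mu * 'C(j, i)%:R : R) * (n%:R ^+ i * mu ^+ n)).
by rewrite (mulrC mu 'C(j, i)%:R) mulrACA.
Qed.

Lemma shift_op_Lspace mu s y : Lspace mu s y -> Lspace mu s (shift_op y).
Proof.
have h (j : 'I_s.+1) : shift_op (npow mu j) =
    \sum_(i < s.+1) (mu * 'C(j, i)%:R) *: npow mu i.
  rewrite shift_op_npow (big_ord_widen s.+1 (fun i => (mu * 'C(j, i)%:R) *: npow mu i)) //.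
  rewrite big_mkcond; apply: eq_bigr => i _.
  by case: ltnP => // ji; rewrite bin_small // mulr0 scale0r.
case=> c _ <-; exists (\col_i \sum_j c j 0 * (mu * 'C(j, i)%:R)) => //.
rewrite /lincomb linear_sum /=.
under [RHS]eq_bigr => j _.
  rewrite linearZ /= /pbasis add0n h scaler_sumr.
  over.
rewrite exchange_big; apply: eq_bigr => i _; rewrite mxE scaler_suml.
by apply: eq_bigr => j _; rewrite scalerA.
Qed.

End Equation.

(* Main.v *)
Require Import Defs.
From HB Require Import structures.
From mathcomp Require Import all_boot all_order all_algebra.
From mathcomp Require Import ring.
From mathcomp Require Import boolp classical_sets functions reals.
Set Implicit Arguments.
Unset Strict Implicit.
Unset Printing Implicit Defensive.

Import Order.TTheory GRing.Theory Num.Theory.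
Local Open Scope classical_set_scope.
Local Open Scope ring_scope.

(** Write P for the characteristic polynomial, so that the operator is P(T), and
    let E = X d/dX be the Euler derivation on polynomials.  Shifting e times
    and expanding (n + e)^j by the binomial formula gives

      T^e (n^j mu^n) = sum_(i <= j) C(j, i) e^(j-i) mu^e n^i mu^n,

    and e^l mu^e is the value at mu of E^l X^e.  By linearity in P,

      P(T) (n^j mu^n) = sum_(i <= j) C(j, i) (E^(j-i) P)(mu) n^i mu^n

    ([Rop_npow]).  The numbers (E^l P)(mu), called moments below, detect the
    multiplicity m of mu: for mu != 0 they vanish for l < m and not for l = m
    ([moment_mup]).

    Hence P(T) lowers the degree in n by exactly m.  It kills the span K of
    mu^n, ..., n^(m-1) mu^n, and it maps n^(m+j) mu^n to a combination of
    the n^i mu^n with i <= j whose top coefficient C(m+j, j) (E^m P)(mu) is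
    nonzero.  So the matrix of P(T) from
    span(n^m mu^n, ..., n^(m+s) mu^n) to span(mu^n, ..., n^s mu^n), which is
    the truncated matrix of the statement, is upper triangular and invertible
    ([Rop_pbasis], [Rmmx_unit]).  Existence, the description of the kernel and
    both claims about the linear system follow.  A number mu that is not
    characteristic is the case m = 0, in which nothing is truncated. *)

(** * Coordinates in a finite family *)

Section LinearCombinations.
Variables (R : realType) (V : lmodType R).

Fact lincomb_is_linear (d : nat) (b : 'I_d -> V) : linear (lincomb b).
Proof.
move=> x u v; rewrite /lincomb scaler_sumr -big_split /=.
by apply: eq_bigr => i _; rewrite !mxE scalerDl scalerA.
Qed.
HB.instance Definition _ (d : nat) (b : 'I_d -> V) :=
  GRing.isLinear.Build R 'cV[R]_d V *:%R (lincomb b) (lincomb_is_linear b).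

Lemma lincomb_delta (d : nat) (b : 'I_d -> V) (j : 'I_d) :
  lincomb b (delta_mx j 0) = b j.
Proof.
rewrite /lincomb (bigD1 j) //= mxE !eqxx scale1r big1 ?addr0 // => i ij.
by rewrite mxE (negPf ij) scale0r.
Qed.

Lemma lincomb_span (d : nat) (b : 'I_d -> V) (c : 'cV[R]_d) :
  lin_span b (lincomb b c).
Proof. by exists c. Qed.

Lemma lincomb_inj (d : nat) (b : 'I_d -> V) :
  free_family b -> injective (lincomb b).
Proof. by move=> bfree; apply: can_inj (coordcolK bfree). Qed.

Lemma lincomb_matrix_of (d : nat) (b : 'I_d -> V) (A : {linear V -> V})
    (c : 'cV[R]_d) :
  (forall y, lin_span b y -> lin_span b (A y)) ->
  lincomb b (matrix_of b A *m c) = A (lincomb b c).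
Proof.
move=> Ab; rewrite {2}/lincomb linear_sum /=.
have -> : matrix_of b A *m c = \sum_j c j 0 *: coordcol b (A (b j)).
  apply/matrixP => i z; rewrite [z]ord1 !mxE summxE.
  by apply: eq_bigr => j _; rewrite !mxE mulrC.
rewrite linear_sum; apply: eq_bigr => j _; rewrite !linearZ /= coordcolP //.
by apply: Ab; rewrite -(lincomb_delta b j); apply: lincomb_span.
Qed.

End LinearCombinations.

(** * Moments of a polynomial and multiplicity of a root *)

Section Moments.
Variable R : realType.
Implicit Types (p q : {poly R}) (mu : R).

Definition euler p : {poly R} := 'X * p^`().

(** If p is the sum of the p_e X^e, this is the sum of the p_e e^l mu^e.  In
    this form the effect of a root of p at mu can be read off by the product
    rule. *)
Definition moment mu (l : nat) p : R := (iter l euler p).[mu].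

Fact moment_is_scalar mu (l : nat) : scalar (moment mu l).
Proof.
move=> c p q; rewrite /moment -[RHS]/(_ * _ + _) -hornerZ -hornerD.
congr (_.[mu]); elim: l => //= l ->.
by rewrite /euler derivD derivZ mulrDr scalerAr.
Qed.
HB.instance Definition _ mu (l : nat) :=
  GRing.isLinear.Build R {poly R} R *%R (moment mu l) (moment_is_scalar mu l).

Lemma moment_Xn mu (l e : nat) : moment mu l 'X^e = e%:R ^+ l * mu ^+ e.
Proof.
have -> : moment mu l 'X^e = (e%:R ^+ l *: 'X^e).[mu]; last first.
  by rewrite hornerZ hornerXn.
congr (_.[mu]).
elim: l => [|l IHl] /=; first by rewrite expr0 scale1r.
rewrite IHl /euler derivZ derivXn -scalerAr mulrnAr -scaler_nat scalerA exprSr.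
by case: e {IHl} => [|e]; rewrite ?mulr0 ?scale0r // -exprS.
Qed.

(** For mu != 0 the Euler derivation lowers the multiplicity of the root mu by
    exactly one, hence induction on m. *)
Lemma moment_mul_XsubC mu (m : nat) q :
  mu != 0 -> ~~ root q mu ->
  (forall l, (l < m)%N -> moment mu l (('X - mu%:P) ^+ m * q) = 0) /\
  moment mu m (('X - mu%:P) ^+ m * q) != 0.
Proof.
move=> mu0; elim: m q => [|m IHm] q qmu; first by split=> //; rewrite mul1r.
(* The cofactor of euler (('X - mu) ^+ m.+1 * q); at mu it equals
   (m + 1) * mu * q(mu), nonzero since mu != 0 in characteristic 0. *)
pose q' := (m.+1%:R * q + ('X - mu%:P) * q^`()) * 'X.
have eulerE : euler (('X - mu%:P) ^+ m.+1 * q) = ('X - mu%:P) ^+ m * q'.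
  rewrite /euler /q' derivM deriv_exp derivXsubC /= mul1r exprS.
  by rewrite -mulr_natl; ring.
have q'mu : ~~ root q' mu.
  rewrite /root /q' !hornerE subrr mul0r addr0 -polyC_natr hornerC.
  by rewrite !mulf_neq0 // pnatr_eq0.
have [low top] := IHm q' q'mu.
have momentS l p : moment mu l.+1 p = moment mu l (euler p).
  by rewrite /moment iterSr.
split; last by rewrite momentS eulerE.
case=> [|l] lm; last by rewrite momentS eulerE low.
by rewrite /moment /= exprS !hornerE subrr !mul0r.
Qed.

(** [moment_mul_XsubC] applied to the factorization that defines the
    multiplicity. *)
Lemma moment_mup mu p :
  mu != 0 -> p != 0 ->
  (forall l, (l < mup mu p)%N -> moment mu l p = 0) /\
  moment mu (mup mu p) p != 0.
Proof.
move=> mu0 p0.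
have : ('X - mu%:P) ^+ mup mu p %| p by rewrite -mup_geq.
rewrite dvdp_eq => /eqP pE.
have qmu : ~~ root (p %/ ('X - mu%:P) ^+ mup mu p) mu.
  have := leqnn (mup mu p); rewrite mup_leq //; apply: contra.
  move=> /factor_theorem[q qE].
  by rewrite [X in _ %| X]pE qE -mulrA -exprS dvdp_mull.
have := moment_mul_XsubC (mup mu p) mu0 qmu.
by rewrite mulrC -pE.
Qed.

End Moments.

(** * The difference operator on the sequences n^j mu^n *)

Section OperatorOnPowers.
Variable R : realType.
Implicit Types (mu : R) (a : nat -> R) (k m s j : nat).

Fact iter_shift_is_linear (e : nat) : linear (iter e (@shift_op R)).
Proof. by move=> c u v; elim: e => //= e ->; rewrite linearP. Qed.
HB.instance Definition _ (e : nat) :=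
  GRing.isLinear.Build R (SR R) (SR R) *:%R (iter e (@shift_op R))
    (iter_shift_is_linear e).

Fact Rop_is_linear k a : linear (@Rop R k a).
Proof.
move=> c u v; rewrite /Rop linearP scalerDr addrACA; congr (_ + _).
rewrite scaler_sumr -big_split /=; apply: eq_bigr => i _.
by rewrite linearP scalerDr !scalerA mulrC.
Qed.
HB.instance Definition _ k a :=
  GRing.isLinear.Build R (SR R) (SR R) *:%R (@Rop R k a) (Rop_is_linear k a).

Lemma iter_shift_cls (e : nat) (y : rseq R) :
  iter e (@shift_op R) (cls y) = cls (fun n => y (n + e)%N).
Proof.
elim: e => [|e IHe] /=; first by congr cls; apply/funext => n; rewrite addn0.
rewrite IHe shift_opE; congr cls; apply/funext => n.
by rewrite /seq_shift addSnnS.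
Qed.

(** Expand (n + e)^j by the binomial formula; the coefficient e^(j - i) mu^e is
    expressed as a moment to make it linear in the polynomial 'X^e. *)
Lemma iter_shift_npow mu (e j : nat) :
  iter e (@shift_op R) (npow mu j) =
  \sum_(i < j.+1) ('C(j, i)%:R * moment mu (j - i) 'X^e) *: npow mu i.
Proof.
rewrite /npow iter_shift_cls; under eq_bigr => i _ do rewrite -clsZ.
rewrite -cls_sum; congr cls; apply/funext => n; rewrite fct_sumE.
rewrite natrD exprD addrC exprDn mulr_suml; apply: eq_bigr => i _.
rewrite moment_Xn -[RHS]/((_ * _) * (n%:R ^+ i * mu ^+ n) : R) -mulr_natl.
by ring.
Qed.

Lemma Rop_npow k a mu j :
  Rop k a (npow mu j) =
  \sum_(i < j.+1) ('C(j, i)%:R * moment mu (j - i) (charpol k a)) *: npow mu i.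
Proof.
rewrite /Rop; under eq_bigr => e _ do rewrite iter_shift_npow scaler_sumr.
rewrite iter_shift_npow exchange_big -big_split /=; apply: eq_bigr => i _.
under eq_bigr => e _ do rewrite scalerA.
rewrite -scaler_suml -scalerDl; congr (_ *: _).
rewrite /charpol linearD linear_sum /= mulrDr mulr_sumr; congr (_ + _).
by apply: eq_bigr => e _; rewrite linearZ /= mulrCA.
Qed.

(** When the first m moments vanish, only i <= j - m contributes, and for
    j <= m + s these indices lie below s + 1.  A sum of fixed length, whatever
    j is, gives the columns of a matrix directly. *)
Lemma Rop_npow_trunc k a mu m s j :
  (forall l, (l < m)%N -> moment mu l (charpol k a) = 0) -> (j <= m + s)%N ->
  Rop k a (npow mu j) =
  \sum_(i < s.+1)
     ('C(j, i)%:R * moment mu (j - i) (charpol k a)) *: npow mu i.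
Proof.
move=> low jms; rewrite Rop_npow.
pose F i := ('C(j, i)%:R * moment mu (j - i) (charpol k a)) *: npow mu i.
have F0 i : (j < i + m)%N -> F i = 0.
  move=> jim; rewrite /F; case: (leqP i j) => [ij|ji].
    by rewrite low ?mulr0 ?scale0r // ltn_subLR.
  by rewrite bin_small // mul0r scale0r.
(* All terms with i > j - m vanish, so any two sums long enough to contain the
   others agree; the length (j + s).+1 dominates both sides. *)
have sumF (n : nat) : (n <= (j + s).+1)%N -> (j < n + m)%N ->
    \sum_(i < n) F i = \sum_(i < (j + s).+1) F i.
  move=> nle jn; rewrite (big_ord_widen _ F nle) big_mkcond /=.
  apply: eq_bigr => i _; case: ltnP => // ni.
  by rewrite F0 // (leq_trans jn) // leq_add2r.
have jsm : (j < s.+1 + m)%N by rewrite addSn ltnS addnC.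
by rewrite [LHS]sumF ?leq_addr // [RHS]sumF // ltnS leq_addl.
Qed.

(** Taking matrices is compatible with powers and linear combinations, since
    the span is stable under the shift. *)
Lemma lincomb_Rmx k a mu s (c : 'cV[R]_s.+1) :
  lincomb (pbasis mu 0 (d:=s.+1)) (Rmx k a mu s *m c) =
  Rop k a (lincomb (pbasis mu 0 (d:=s.+1)) c).
Proof.
have TX (e : nat) : lincomb (pbasis mu 0 (d:=s.+1)) (Tmx mu s ^+ e *m c) =
    iter e (@shift_op R) (lincomb (pbasis mu 0 (d:=s.+1)) c).
  elim: e => [|e IHe] /=; first by rewrite mul1mx.
  rewrite exprS -mulmxA -IHe lincomb_matrix_of // => y.
  exact: shift_op_Lspace.
rewrite /Rop /Rmx mulmxDl linearD /= TX mulmx_suml; congr (_ + _).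
rewrite [LHS]linear_sum; apply: eq_bigr => i _.
by rewrite -scalemxAl linearZ /= TX.
Qed.

Lemma Rmx_entry k a mu s (i j : 'I_s.+1) :
  mu != 0 ->
  Rmx k a mu s i j = 'C(j, i)%:R * moment mu (j - i) (charpol k a).
Proof.
move=> mu0.
suff /lincomb_inj E : lincomb (pbasis mu 0 (d:=s.+1)) (col j (Rmx k a mu s)) =
    lincomb (pbasis mu 0 (d:=s.+1))
      (\col_i ('C(j, i)%:R * moment mu (j - i) (charpol k a))).
  by have /matrixP/(_ i 0) := E (pbasis_free mu0); rewrite !mxE.
rewrite colE lincomb_Rmx lincomb_delta /pbasis add0n.
rewrite (@Rop_npow_trunc k a mu 0 s) //; last by rewrite -ltnS.
by apply: eq_bigr => l _; rewrite mxE.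
Qed.

Lemma Rmmx_entry k a mu m s (i j : 'I_s.+1) :
  mu != 0 ->
  Rmmx k a mu m s i j =
  'C(m + j, i)%:R * moment mu (m + j - i) (charpol k a).
Proof.
move=> mu0; have ims : (i < (m + s).+1)%N.
  by rewrite (leq_trans (ltn_ord i)) // ltnS leq_addl.
have jms : (m + j < (m + s).+1)%N by rewrite ltnS leq_add2l -ltnS.
by rewrite mxE Rmx_entry // !inordK.
Qed.

(** In the columns that are kept, the last m rows of the full matrix vanish
    because P(T) lowers the degree in n by m; hence deleting those rows loses
    nothing. *)
Lemma Rop_pbasis k a mu m s (c : 'cV[R]_s.+1) :
  mu != 0 -> (forall l, (l < m)%N -> moment mu l (charpol k a) = 0) ->
  Rop k a (lincomb (pbasis mu m (d:=s.+1)) c) =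
  lincomb (pbasis mu 0 (d:=s.+1)) (Rmmx k a mu m s *m c).
Proof.
move=> mu0 low.
have -> : Rmmx k a mu m s *m c = \sum_j c j 0 *: col j (Rmmx k a mu m s).
  apply/matrixP => i z; rewrite [z]ord1 !mxE summxE.
  by apply: eq_bigr => j _; rewrite !mxE mulrC.
rewrite {1}/lincomb !linear_sum; apply: eq_bigr => j _; rewrite !linearZ /=.
congr (_ *: _); rewrite (@Rop_npow_trunc k a mu m s) //; last first.
  by rewrite leq_add2l -ltnS.
apply: eq_bigr => i _.
by rewrite [col _ _ _ _]mxE Rmmx_entry.
Qed.

(** Entry (i, j) contains the moment of order m + j - i, which vanishes below
    the diagonal; on the diagonal it is the nonzero moment of order m.  The
    transpose appears because triangular means lower triangular in
    [det_trig]. *)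
Lemma Rmmx_unit k a mu m s :
  mu != 0 -> (forall l, (l < m)%N -> moment mu l (charpol k a) = 0) ->
  moment mu m (charpol k a) != 0 -> Rmmx k a mu m s \in unitmx.
Proof.
move=> mu0 low top; rewrite -unitmx_tr unitmxE det_trig.
  rewrite unitfE; apply/prodf_neq0 => i _; rewrite mxE Rmmx_entry // addnK.
  by rewrite mulf_neq0 // pnatr_eq0 -lt0n bin_gt0 leq_addl.
apply/is_trig_mxP => j i ji; rewrite mxE Rmmx_entry //.
case: (leqP i (m + j)) => ijm; last by rewrite bin_small ?mul0r.
by rewrite low ?mulr0 // ltn_subLR // addnC ltn_add2r.
Qed.

Lemma Rop_Kspace k a mu m y :
  (forall l, (l < m)%N -> moment mu l (charpol k a) = 0) ->
  Kspace mu m y -> Rop k a y = 0.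
Proof.
move=> low [c _ <-]; rewrite /lincomb linear_sum big1 // => j _.
rewrite linearZ /= Rop_npow big1 ?scaler0 // => i _.
rewrite low ?mulr0 ?scale0r //.
exact: leq_ltn_trans (leq_subr _ _) (ltn_ord j).
Qed.

Lemma lincomb_pbasis_col mu p d1 d2 (c1 : 'cV[R]_d1) (c2 : 'cV[R]_d2) :
  lincomb (pbasis mu p (d:=d1 + d2)) (col_mx c1 c2) =
  lincomb (pbasis mu p (d:=d1)) c1 + lincomb (pbasis mu (p + d1) (d:=d2)) c2.
Proof.
rewrite /lincomb big_split_ord; congr (_ + _); apply: eq_bigr => i _.
  by rewrite col_mxEu.
by rewrite col_mxEd /pbasis /= addnA.
Qed.

(** Both families together are the basis of the large space, so the sum is its
    span and the intersection is trivial by freeness. *)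
Lemma Lspace_direct_sum mu m s :
  mu != 0 -> direct_sum (Lspace mu (m + s)) (Kspace mu m) (Lmspace mu m s).
Proof.
move=> mu0; rewrite /Lspace -addnS; split; apply/seteqP; split=> y /=.
- case=> c _ <-; rewrite -[c]vsubmxK lincomb_pbasis_col.
  exists (lincomb (pbasis mu 0 (d:=m)) (usubmx c)).
    exact: lincomb_span.
  exists (lincomb (pbasis mu m (d:=s.+1)) (dsubmx c)) => //.
  exact: lincomb_span.
- case=> _ [c1 _ <-] [_ [c2 _ <-] <-].
  exists (col_mx c1 c2) => //; exact: lincomb_pbasis_col.
- case=> -[c1 _ <-] [c2 _ c12].
  have /(pbasis_free mu0)/eqP :
      lincomb (pbasis mu 0 (d:=m + s.+1)) (col_mx c1 (- c2)) = 0.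
    by rewrite lincomb_pbasis_col linearN /= add0n c12 subrr.
  by rewrite col_mx_eq0 => /andP[/eqP-> _]; rewrite linear0.
- move=> ->; split; exists 0 => //; exact: linear0.
Qed.

Lemma charpol_neq0 k a : charpol k a != 0.
Proof.
apply/negP => /eqP/(congr1 (fun p : {poly R} => p`_k)).
rewrite /charpol coefD coefXn eqxx coef0 coef_sum big_nat big1 ?addr0.
  by move/eqP; rewrite oner_eq0.
move=> i /andP[i0 ik]; rewrite coefZ coefXn gtn_eqF ?mulr0 //.
by rewrite ltn_subrL i0 (leq_trans i0).
Qed.

End OperatorOnPowers.

(** * Solving the equation for a root of multiplicity m >= 0 *)

Section ParticularSolution.
Variables (R : realType) (k : nat) (a : nat -> R) (mu : R) (m s : nat).
Variable f : SR R.
Hypotheses (mu0 : mu != 0) (fL : Lspace mu s f).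
Hypothesis mupm : mup mu (charpol k a) = m.

Let low : forall l, (l < m)%N -> moment mu l (charpol k a) = 0.
Proof. by rewrite -mupm; case: (moment_mup mu0 (charpol_neq0 k a)). Qed.

Let RmmxU : Rmmx k a mu m s \in unitmx.
Proof.
apply: Rmmx_unit => //; rewrite -mupm.
by case: (moment_mup mu0 (charpol_neq0 k a)).
Qed.

Let Lmspace_sub y : Lmspace mu m s y -> Lspace mu (m + s) y.
Proof.
move=> Ly; have [-> _] := Lspace_direct_sum m s mu0.
exists 0; first by exists 0 => //; exact: linear0.
by exists y; rewrite ?add0r.
Qed.

Lemma Rop_pbasis_eq (c : 'cV[R]_s.+1) :
  Rop k a (lincomb (pbasis mu m (d:=s.+1)) c) = f <->
  Rmmx k a mu m s *m c = coordcol (pbasis mu 0 (d:=s.+1)) f.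
Proof.
rewrite Rop_pbasis //; split=> [<-|->]; last exact: coordcolP.
by rewrite coordcolK //; apply: pbasis_free.
Qed.

Lemma Rmmx_unique_solution :
  exists! c, Rmmx k a mu m s *m c = coordcol (pbasis mu 0 (d:=s.+1)) f.
Proof.
exists (invmx (Rmmx k a mu m s) *m coordcol (pbasis mu 0 (d:=s.+1)) f).
by split=> [|c <-]; rewrite ?mulKVmx ?mulKmx.
Qed.

Lemma exists_solution_Lmspace :
  exists2 y : SR R, Lmspace mu m s y & Rop k a y = f.
Proof.
have [c [/Rop_pbasis_eq cf _]] := Rmmx_unique_solution.
by exists (lincomb (pbasis mu m (d:=s.+1)) c) => //; apply: lincomb_span.
Qed.

Lemma exists_solution_Lspace :
  exists2 y : SR R, Lspace mu (m + s) y & Rop k a y = f.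
Proof.
by have [y /Lmspace_sub yL yf] := exists_solution_Lmspace; exists y.
Qed.

(** P(T) kills K and is injective on the complement of K, by invertibility of
    the truncated matrix. *)
Lemma Kspace_ker :
  Kspace mu m = [set y | Lspace mu (m + s) y /\ Rop k a y = 0].
Proof.
have [LE _] := Lspace_direct_sum m s mu0.
apply/seteqP; split=> y /=.
  move=> yK; split; last exact: Rop_Kspace yK.
  rewrite LE; exists y => //; exists 0; rewrite ?addr0 //.
  by exists 0 => //; exact: linear0.
rewrite LE => -[[u uK [_ [c _ <-] <-]]].
rewrite linearD /= (Rop_Kspace low uK) add0r Rop_pbasis // => Rc0.
have {}Rc0 := pbasis_free mu0 Rc0.
by rewrite -(mulKmx RmmxU c) Rc0 mulmx0 linear0 addr0.
Qed.

(** P(T) does not distinguish a solution y from its projection v, because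
    y - v lies in K; so the condition on y is one on the coordinates of v.
    Conversely a solution of the system gives a y that is its own
    projection. *)
Lemma projection_system (c : 'cV[R]_s.+1) :
  (exists y v : SR R,
     [/\ Lspace mu (m + s) y, Rop k a y = f,
         is_projection (Kspace mu m) (Lmspace mu m s) y v
       & coordcol (pbasis mu m (d:=s.+1)) v = c])
  <-> Rmmx k a mu m s *m c = coordcol (pbasis mu 0 (d:=s.+1)) f.
Proof.
split=> [[y [v [_ yf [vL yvK] <-]]]|/Rop_pbasis_eq cf].
  apply/Rop_pbasis_eq; rewrite coordcolP // -yf.
  by have /eqP := Rop_Kspace low yvK; rewrite linearB subr_eq0 => /eqP.
have vL := lincomb_span (pbasis mu m (d:=s.+1)) c.
exists (lincomb (pbasis mu m (d:=s.+1)) c).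
exists (lincomb (pbasis mu m (d:=s.+1)) c).
split=> //; first exact: Lmspace_sub.
  by split=> //; rewrite subrr; exists 0 => //; exact: linear0.
by rewrite coordcolK //; apply: pbasis_free.
Qed.

End ParticularSolution.

Lemma Rmmx0 (R : realType) (k : nat) (a : nat -> R) (mu : R) (s : nat) :
  Rmmx k a mu 0 s = Rmx k a mu s.
Proof. by apply/matrixP => i j; rewrite mxE !inord_val. Qed.

Theorem theorem3 (R : realType) (k : nat) (a : nat -> R) (mu : R) (s : nat)
    (f : SR R) (hk : (1 <= k)%N) (hak : a k != 0) (hmu : mu != 0)
    (hf : Lspace mu s f) :
  (~~ root (charpol k a) mu ->
    [/\ exists2 y : SR R, Lspace mu s y & Rop k a y = f,
        forall c : 'cV[R]_(s.+1),
          (exists y : SR R,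
            [/\ Lspace mu s y, Rop k a y = f
              & coordcol (pbasis mu 0 (d:=s.+1)) y = c])
          <-> Rmx k a mu s *m c = coordcol (pbasis mu 0 (d:=s.+1)) f
      & exists! c : 'cV[R]_(s.+1),
          Rmx k a mu s *m c = coordcol (pbasis mu 0 (d:=s.+1)) f])
  /\
  (forall m : nat, (1 <= m)%N -> root (charpol k a) mu ->
      mup mu (charpol k a) = m ->
    [/\ exists2 y : SR R, Lspace mu (m + s) y & Rop k a y = f,
        direct_sum (Lspace mu (m + s)) (Kspace mu m) (Lmspace mu m s),
        Kspace mu m = [set y | Lspace mu (m + s) y /\ Rop k a y = 0],
        forall c : 'cV[R]_(s.+1),
          (exists y v : SR R,
            [/\ Lspace mu (m + s) y, Rop k a y = f,
                is_projection (Kspace mu m) (Lmspace mu m s) y v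
              & coordcol (pbasis mu m (d:=s.+1)) v = c])
          <-> Rmmx k a mu m s *m c = coordcol (pbasis mu 0 (d:=s.+1)) f
      & exists! c : 'cV[R]_(s.+1),
          Rmmx k a mu m s *m c = coordcol (pbasis mu 0 (d:=s.+1)) f]).
Proof.
split=> [/mupNroot mup0 | m _ _ mupm]; last first.
  split.
  - exact: exists_solution_Lspace.
  - exact: Lspace_direct_sum.
  - exact: Kspace_ker.
  - exact: projection_system.
  - exact: Rmmx_unique_solution.
(* For multiplicity 0 the complement of K is the whole space, definitionally,
   and K is the span of the empty family. *)
split; first exact: (exists_solution_Lspace hmu hf mup0).
  move=> c; rewrite -Rmmx0; split=> [[y [yL yf yc]]|].
    apply/(projection_system hmu hf mup0); exists y, y; split=> //.
    by split=> //; rewrite subrr; exists 0 => //; exact: linear0.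
  move=> /(Rop_pbasis_eq hmu hf mup0) cf.
  exists (lincomb (pbasis mu 0 (d:=s.+1)) c).
  split=> //; first exact: lincomb_span.
  by rewrite coordcolK //; apply: pbasis_free.
by have := Rmmx_unique_solution s f hmu mup0; rewrite Rmmx0.
Qed.
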